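(* Let $h\ge 2$, let $n_1,\ldots,n_h$ be positive integers, and let the deck $D$ be a permutation of the multiset $\{1^{n_1},2^{n_2},\ldots,h^{n_h}\}$. Let $1\le e<h$ and $f=e+1$. Put $N=n_1+\cdots+n_h$, $N_1=n_1+\cdots+n_e$ and $N_2=N-N_1$. Let $D_{1e}$ be the deck obtained from $D$ by keeping the cards labeled $1,\ldots,e$ and discarding the others, and $D_{fh}$ the deck obtained from $D$ by keeping the cards labeled $f,\ldots,h$ and discarding the others (in both cases keeping the order of the remaining cards). Define polynomials as follows. (1) For $1\le i\le n_1$, $1\le j\le n_h$, the coefficient of $x^d$ in $p_{i,j}(x)$ is the number of shuffles $\pi$ from $1^{n_1},2^{n_2},\ldots,h^{n_h}$ to $D$ with exactly $d$ descents such that $\pi(1)=D(i,1)$ and $\pi(N)=D(j,h)$. (2) For $1\le i\le n_1$, $1\le k\le n_e$, the coefficient of $x^d$ in $q_{i,k}(x)$ is the number of shuffles $\pi$ from $1^{n_1},\ldots,e^{n_e}$ to $D_{1e}$ with exactly $d$ descents such that $\pi(1)=D_{1e}(i,1)$ and $\pi(N_1)=D_{1e}(k,e)$. (3) For $1\le l\le n_f$, $1\le j\le n_h$, the coefficient of $x^d$ in $r_{l,j}(x)$ is the number of shuffles $\pi$ from $f^{n_f},\ldots,h^{n_h}$ to $D_{fh}$ with exactly $d$ descents such that $\pi(1)=D_{fh}(l,f)$ and $\pi(N_2)=D_{fh}(j,h)$. Then for all $1\le i\le n_1$ and $1\le j\le n_h$, $$p_{i,j}(x)=\sum_{k=1}^{n_e}\sum_{l=1}^{n_f}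 q_{i,k}(x)\,r_{l,j}(x)\,x^{\varepsilon(k,l)},$$ where $\varepsilon(k,l)=0$ if $D(k,e)<D(l,f)$ and $\varepsilon(k,l)=1$ if $D(k,e)>D(l,f)$.
   Context: A deck of $N$ cards is a finite sequence of $N$ labels, listed from top to bottom; labels may repeat. The notation $c^m$ means $m$ consecutive cards labeled $c$. For a deck $E$ (such as $D$, $D_{1e}$, $D_{fh}$), $E(i,c)$ denotes the position in $E$ of the $i$th card labeled $c$; for example if $E=1,2,1,1,2,2$ then $E(2,1)=3$. A shuffle of $N$ cards is a permutation $\pi\in S_N$; it is a shuffle from the deck $c_1,\ldots,c_N$ to the deck $c_{\pi^{-1}(1)},\ldots,c_{\pi^{-1}(N)}$ (i.e. the card in position $i$ is sent to position $\pi(i)$). The number of descents of $\pi$ is the number of positions $1\le i<N$ with $\pi(i)>\pi(i+1)$. *)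

(* Defs.v *)
From HB Require Import structures.
From mathcomp Require Import all_boot all_order all_algebra all_fingroup.

Set Implicit Arguments.
Unset Strict Implicit.
Unset Printing Implicit Defensive.

Import GRing.Theory.

(* Positions of cards are numbered from 1, from top to bottom. *)

Definition deck := seq nat.

(* The deck a^(n a), (a+1)^(n (a+1)), ..., b^(n b). *)
Definition blocks (n : nat -> nat) (a b : nat) : deck :=
  flatten [seq nseq (n c) c | c <- index_iota a b.+1].

(* E(i, c); the default value 0 is taken only when i is not between 1 and the
   number of cards labeled c. *)
Definition card_pos (E : deck) (i c : nat) : nat :=
  nth 0 [seq k <- index_iota 1 (size E).+1 | nth 0 E k.-1 == c] i.-1.

(* The cards of E whose labels lie between a and b, in the order of E. *)
Definition subdeck (E : deck) (a b : nat) : deck := [seq c <- E | a <= c <= b].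

(* 'S_N acts on {0, ..., N-1}; sh_at pi i is the value at i of pi seen as a
   permutation of {1, ..., N}, and 0 when i is not in this range. *)
Definition sh_at N (pi : 'S_N) (i : nat) : nat :=
  if i is k.+1 then
    if insub k is Some k' then (pi k' : nat).+1 else 0
  else 0.

Definition shuffle_from_to N (s t : deck) (pi : 'S_N) : bool :=
  (size s == N) && (t == [seq nth 0 s ((pi^-1)%g j) | j <- enum 'I_N]).

Definition descents N (pi : 'S_N) : nat :=
  count (fun i => sh_at pi i.+1 < sh_at pi i) (index_iota 1 N).

Definition nb_shuffles N (s t : deck) (a b d : nat) : nat :=
  #|[set pi : 'S_N | [&& shuffle_from_to s t pi, descents pi == d,
                         sh_at pi 1 == a & sh_at pi N == b]]|.

Definition shuffle_poly N (s t : deck) (a b : nat) : {poly int} :=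
  (\poly_(d < N.+1) (nb_shuffles N s t a b d)%:R)%R.

(* The truncation at degree N in shuffle_poly loses no coefficient. *)
Lemma coef_shuffle_poly N (s t : deck) (a b d : nat) :
  ((shuffle_poly N s t a b)`_d = (nb_shuffles N s t a b d)%:R)%R.
Proof.
rewrite coef_poly; case: ltnP => // ltNd.
suff -> : nb_shuffles N s t a b d = 0 by [].
apply: eq_card0 => pi; rewrite !inE; apply/negP => /and4P[_ /eqP desd _ _].
have : descents pi <= N.
  by apply: leq_trans (count_size _ _) _; rewrite size_iota leq_subr.
by rewrite desd leqNgt ltNd.
Qed.

(* Main.v *)
Require Import Defs.
From mathcomp Require Import all_boot all_order all_algebra all_fingroup.

Import GRing.Theory.

(** A shuffle pi is determined by its word pi(1), ..., pi(N) of positions in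
    the target deck, and it is a shuffle to D exactly when the labels read along
    the word form the source deck.  Since the labels 1, ..., e precede f, ..., h
    in the source, such a word is the concatenation of a word in the positions
    labeled 1, ..., e and a word in those labeled f, ..., h.  Its descents are
    those of the two parts, plus one at the junction when the last letter
    D(k, e) of the first part exceeds the first letter D(l, f) of the second.
    Discarding cards relabels positions monotonically, so the two parts are the
    words of shuffles to the subdecks, with the same descents. *)

(** * Descents of words *)

Definition seq_descents (w : seq nat) : nat :=
  if w is x :: w' then count id (pairmap (fun y z => z < y) x w') else 0.

Lemma seq_descents_cat u v : u != [::] -> v != [::] ->
  seq_descents (u ++ v) =
  (seq_descents u + seq_descents v + (head 0 v < last 0 u))%N.
Proof.
case: u v => [|x u] [|y v] //= _ _.
by rewrite pairmap_cat count_cat /= addnCA [RHS]addnC addnA.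
Qed.

(** Links the recursive form, suited to concatenation, with the indexed count used by [descents];
    positions there start at 1, hence the shift [i.-1]. *)
Lemma seq_descentsE w : seq_descents w =
  count (fun i => nth 0 w i < nth 0 w i.-1) (index_iota 1 (size w)).
Proof.
case: w => [|x w] //=; rewrite /index_iota subn1 /=.
have -> : iota 1 (size w) = [seq i.+1 | i <- iota 0 (size w)].
  by rewrite -(iotaDl 1).
rewrite count_map -[pairmap _ x w](mkseq_nth false) size_pairmap count_map.
by apply: eq_in_count => i; rewrite mem_iota /= => ltiw; rewrite (nth_pairmap 0).
Qed.

(** * Shuffles as words of positions *)

Lemma sh_atE N (pi : 'S_N) (i : 'I_N) : sh_at pi i.+1 = (pi i).+1.
Proof. by rewrite /sh_at valK. Qed.

(** The alphabet [P] is a parameter so that cards of a subdeck keep their positions in the full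
    deck: words for the two subdecks can then be concatenated and compared at the junction. *)
Definition word (P : seq nat) (pi : 'S_(size P)) : seq nat :=
  [seq nth 0 P (pi i) | i <- enum 'I_(size P)].

Lemma size_word P pi : size (word P pi) = size P.
Proof. by rewrite size_map size_enum_ord. Qed.

Lemma nth_word P pi (i : 'I_(size P)) :
  nth 0 (word P pi) i = nth 0 P (pi i).
Proof. by rewrite (nth_map i) ?size_enum_ord // nth_ord_enum. Qed.

Lemma word_inj P : uniq P -> injective (word P).
Proof.
move=> uP pi rho eqw; apply/permP => i; apply/val_inj/eqP.
by rewrite -(nth_uniq 0 _ _ uP) //= -(nth_word P pi) eqw nth_word.
Qed.

(** The words are distinct rearrangements of [P], and there are as many of them, [(size P)!], as
    rearrangements; so they are all of them. *)
Lemma perm_words P : uniq P ->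
  perm_eq [seq word P pi | pi <- enum 'S_(size P)] (permutations P).
Proof.
move=> uP; have uW: uniq [seq word P pi | pi <- enum 'S_(size P)].
  by rewrite map_inj_uniq ?enum_uniq //; apply: word_inj.
have sWP: {subset [seq word P pi | pi <- enum 'S_(size P)] <= permutations P}.
  move=> _ /mapP[pi _ ->]; rewrite mem_permutations; apply: uniq_perm => //.
    rewrite map_inj_in_uniq ?enum_uniq // => i j _ _ /eqP.
    by rewrite nth_uniq // => /eqP /val_inj /perm_inj.
  move=> x; apply/mapP/idP => [[i _ ->]|Px]; first by rewrite mem_nth.
  have ltx: index x P < size P by rewrite index_mem.
  exists ((pi^-1)%g (Ordinal ltx)); first by rewrite mem_enum.
  by rewrite permKV /= nth_index.
apply: uniq_perm; rewrite ?permutations_uniq //.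
suff szW : size (permutations P)
    <= size [seq word P pi | pi <- enum 'S_(size P)].
  by have [] := uniq_min_size uW sWP szW.
by rewrite size_permutations // size_map -cardE card_Sn.
Qed.

Lemma nth_ltn_sorted P i j : sorted ltn P -> i < size P -> j < size P ->
  (nth 0 P i < nth 0 P j) = (i < j).
Proof.
move=> sP ltiP ltjP; have mono := sorted_ltn_nth ltn_trans 0 sP.
case: (ltngtP i j) => [ltij|ltji|->]; last by rewrite ltnn.
  exact: mono.
by apply/negbTE; rewrite -leqNgt ltnW //; apply: mono.
Qed.

(** Reading ranks in an increasing [P] preserves every comparison of letters. *)
Lemma seq_descents_word P pi : sorted ltn P ->
  seq_descents (word P pi) = descents pi.
Proof.
move=> sP; rewrite seq_descentsE size_word; apply: eq_in_count.
case=> [|i]; rewrite mem_index_iota // => /andP[_ lti]; have ltiP := ltnW lti.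
rewrite (sh_atE _ _ (Ordinal lti)) (sh_atE _ _ (Ordinal ltiP)).
rewrite (nth_word P pi (Ordinal lti)) (nth_word P pi (Ordinal ltiP)).
by rewrite nth_ltn_sorted.
Qed.

Lemma nth_word_eq P pi i a : uniq P -> 0 < i <= size P -> 0 < a <= size P ->
  (nth 0 (word P pi) i.-1 == nth 0 P a.-1) = (sh_at pi i == a).
Proof.
case: i a => [|i] [|a] // uP /andP[_ lti] /andP[_ lta].
rewrite (sh_atE _ _ (Ordinal lti)).
by rewrite (nth_word P pi (Ordinal lti)) nth_uniq.
Qed.

(** Substituting [pi i] for the target position removes the inverse: card [i] of [s] must carry the
    label found at target position [pi i]. *)
Lemma shuffle_word P (lab : nat -> nat) s pi : size s = size P ->
  shuffle_from_to s (map lab P) pi = (map lab (word P pi) == s).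
Proof.
move=> szs; rewrite /shuffle_from_to szs eqxx /=.
have nthE (i : 'I_(size P)) : nth 0 (map lab (word P pi)) i
    = nth 0 (map lab P) (pi i).
  by rewrite (nth_map 0) ?size_word // nth_word (nth_map 0).
apply/eqP/eqP => [eqt | <-].
  apply: (@eq_from_nth _ 0); first by rewrite size_map size_word szs.
  move=> i; rewrite size_map size_word => lti.
  rewrite (nthE (Ordinal lti)) eqt (nth_map (Ordinal lti)) ?size_enum_ord //.
  by rewrite nth_ord_enum permK.
apply: (@eq_from_nth _ 0); first by rewrite size_map [RHS]size_map size_enum_ord.
move=> i; rewrite size_map => lti.
rewrite [RHS](nth_map (Ordinal lti)) ?size_enum_ord //.
by rewrite nthE (nth_ord_enum _ (Ordinal lti)) permKV.
Qed.

Definition word_poly (P : seq nat) (lab : nat -> nat) (s : seq nat)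
    (x y : nat) : {poly int} :=
  (\sum_(w <- permutations P | [&& map lab w == s, head 0 w == x
     & last 0 w == y]) 'X^(seq_descents w))%R.

(** Reindexing by [perm_words] turns the count of permutations into a sum over words. The endpoints
    [a] and [b] are ranks in [P], counted from 1; [word_poly] takes the letters themselves. *)
Lemma shuffle_polyE P lab s a b : sorted ltn P -> size s = size P ->
    0 < a <= size P -> 0 < b <= size P ->
  shuffle_poly (size P) s (map lab P) a b =
  word_poly P lab s (nth 0 P a.-1) (nth 0 P b.-1).
Proof.
move=> sP szs lea leb.
have uP: uniq P by apply: sorted_uniq sP; [apply: ltn_trans | apply: ltnn].
have P_gt0: 0 < size P by case/andP: lea => /leq_trans; apply.
apply/polyP => d; rewrite coef_shuffle_poly /word_poly.
rewrite -(perm_big _ (perm_words P uP)) /= big_map big_enum_cond /= coef_sum.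
rewrite /nb_shuffles -sum1_card natr_sum.
rewrite (eq_bigl (fun pi => [&& map lab (word P pi) == s,
   head 0 (word P pi) == nth 0 P a.-1 & last 0 (word P pi) == nth 0 P b.-1]
   && (d == descents pi))); last first.
  move=> pi; rewrite !inE shuffle_word // -nth0 -nth_last size_word.
  rewrite (@nth_word_eq P pi 1) ?(@nth_word_eq P pi (size P)) ?P_gt0 //=.
  by rewrite (eq_sym d); do !bool_congr.
(* The condition on descents becomes the coefficient at [d] of a single monomial. *)
rewrite big_mkcondr; apply: eq_big => // pi _.
by rewrite coefXn seq_descents_word //; case: eqP.
Qed.

(** * Cutting words at the junction of two label ranges *)

Lemma sum_fibers (T : eqType) (C : seq nat) (A : seq T) (Q : pred T)
    (g : T -> nat) (F : nat -> T -> {poly int}) :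
    uniq C -> {in A, forall w, g w \in C} ->
  (\sum_(x <- C) \sum_(w <- A | Q w && (g w == x)) F x w =
   \sum_(w <- A | Q w) F (g w) w)%R.
Proof.
move=> uC gC; under eq_bigr do rewrite big_mkcondr.
(* After the exchange, each [w] contributes only for [x = g w]. *)
rewrite exchange_big big_seq_cond [RHS]big_seq_cond /=.
apply: eq_bigr => w /andP[/gC Cgw _]; rewrite (bigD1_seq _ Cgw) //= eqxx.
rewrite big1 ?addr0 // => x /negPf; rewrite eq_sym => -> //.
Qed.

(** The labels force the first [size s1] letters to satisfy [p] and the others to violate it, so
    cutting there inverts concatenation, and each half rearranges the matching part of [P]. *)
Lemma perm_words_cat (P : seq nat) (lab : nat -> nat) (p : pred nat) s1 s2 :
    uniq P -> all p s1 -> all (predC p) s2 ->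
  perm_eq [seq w <- permutations P | map lab w == s1 ++ s2]
    [seq u ++ v
      | u <- [seq u <- permutations [seq k <- P | p (lab k)] | map lab u == s1],
        v <- [seq v <- permutations [seq k <- P | ~~ p (lab k)]
             | map lab v == s2]].
Proof.
move=> uP /all_filterP ps1 /all_filterP ps2; apply: uniq_perm.
- exact/filter_uniq/permutations_uniq.
- apply: allpairs_uniq; rewrite ?filter_uniq ?permutations_uniq //.
  move=> [u v] [u' v'] /allpairsP[[u1 v1]] /= [].
  rewrite !mem_filter => /andP[/eqP lu _] _ [-> ->].
  move=> /allpairsP[[u2 v2]] /= []; rewrite !mem_filter.
  move=> /andP[/eqP lu' _] _ [-> ->] /eqP; rewrite eqseq_cat.
    by case/andP=> /eqP-> /eqP->.
  by rewrite -(size_map lab) lu -lu' size_map.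
have pf0 (q : pred nat) s : filter q (filter (predC q) s) = [::].
  by rewrite -filter_predI -(filter_pred0 s); apply: eq_filter => x /=; case: q.
have fp0 (q : pred nat) s : filter (predC q) (filter q s) = [::].
  by rewrite -filter_predI -(filter_pred0 s); apply: eq_filter => x /=; case: q.
move=> w; rewrite mem_filter mem_permutations; apply/andP/allpairsP.
  case=> /eqP lw Pw; exists (take (size s1) w, drop (size s1) w) => /=.
  have lt : map lab (take (size s1) w) = s1 by rewrite map_take lw take_size_cat.
  have ld : map lab (drop (size s1) w) = s2 by rewrite map_drop lw drop_size_cat.
  have pt : filter (preim lab p) (take (size s1) w) = take (size s1) w.
    by apply/all_filterP; rewrite -all_map lt -ps1 filter_all.
  have pd : filter (preim lab (predC p)) (drop (size s1) w) = drop (size s1) w.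
    by apply/all_filterP; rewrite -all_map ld -ps2 filter_all.
  rewrite !mem_filter lt ld !eqxx !mem_permutations cat_take_drop; split=> //=.
    (* Filtering [w] by [p] returns its first half: [pd], used backwards, exhibits the second half
       as a filter by the complement, which [pf0] then erases. *)
    have := perm_filter (preim lab p) Pw.
    rewrite -{1}(cat_take_drop (size s1) w) filter_cat pt -pd.
    by rewrite (pf0 (preim lab p)) cats0.
  have := perm_filter (preim lab (predC p)) Pw.
  rewrite -{1}(cat_take_drop (size s1) w) filter_cat pd -pt.
  by rewrite (fp0 (preim lab p)).
case=> [[u v]] /= []; rewrite !mem_filter !mem_permutations.
move=> /andP[/eqP lu Pu] /andP[/eqP lv Pv] ->; rewrite map_cat lu lv; split=> //.
by rewrite perm_sym -(perm_filterC (preim lab p) P) perm_sym perm_cat.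
Qed.

(** Pairs of half-words are grouped by the two letters [u] and [v] that meet at the junction; once
    these are fixed, the junction factor is constant and the double sum factors. *)
Lemma word_poly_cat (P : seq nat) (lab : nat -> nat) (p : pred nat) s1 s2 x y :
    uniq P -> all p s1 -> all (predC p) s2 -> s1 != [::] -> s2 != [::] ->
  (word_poly P lab (s1 ++ s2) x y =
   \sum_(u <- [seq k <- P | lab k == last 0 s1])
     \sum_(v <- [seq k <- P | lab k == head 0 s2])
       word_poly [seq k <- P | p (lab k)] lab s1 x u *
       word_poly [seq k <- P | ~~ p (lab k)] lab s2 v y * 'X^(v < u))%R.
Proof.
move=> uP ps1 ps2 s1n s2n; rewrite /word_poly.
set A1 := [seq u <- permutations [seq k <- P | p (lab k)] | map lab u == s1].
set A2 := [seq v <- permutations [seq k <- P | ~~ p (lab k)] | map lab v == s2].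
have A1n u : u \in A1 -> u != [::].
  by rewrite mem_filter => /andP[/eqP lu _]; case: u lu s1n => //= <-.
have A2n v : v \in A2 -> v != [::].
  by rewrite mem_filter => /andP[/eqP lu _]; case: v lu s2n => //= <-.
(* The range hypotheses of [sum_fibers]: a junction letter carries the label at the corresponding
   end of [s1] or [s2]. *)
have A1C : {in A1, forall u, last 0 u \in [seq k <- P | lab k == last 0 s1]}.
  move=> u A1u; have := A1n u A1u; move: A1u.
  rewrite !mem_filter mem_permutations => /andP[/eqP <- /perm_mem Pu].
  case: u Pu => [|a u] //= Pu _; rewrite last_map eqxx /=.
  by have := mem_last a u; rewrite Pu mem_filter => /andP[].
have A2C : {in A2, forall v, head 0 v \in [seq k <- P | lab k == head 0 s2]}.
  move=> v A2v; have := A2n v A2v; move: A2v.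
  rewrite !mem_filter mem_permutations => /andP[/eqP <- /perm_mem Pv].
  case: v Pv => [|a v] //= Pv _; rewrite eqxx /=.
  by have := mem_head a v; rewrite Pv mem_filter => /andP[].
rewrite -big_filter_cond (perm_big _ (perm_words_cat _ _ _ _ _ uP ps1 ps2)) /=.
rewrite big_mkcond big_allpairs_dep /= -/A1 -/A2.
transitivity (\sum_(u <- [seq k <- P | lab k == last 0 s1])
    \sum_(w1 <- A1 | (head 0 w1 == x) && (last 0 w1 == u))
     \sum_(v <- [seq k <- P | lab k == head 0 s2])
      \sum_(w2 <- A2 | (last 0 w2 == y) && (head 0 w2 == v))
       'X^(seq_descents w1) * 'X^(seq_descents w2) * 'X^(v < u) : {poly int})%R.
  rewrite sum_fibers ?filter_uniq // [RHS]big_mkcond.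
  apply: eq_big_seq => w1 A1w1; rewrite sum_fibers ?filter_uniq //.
  case: ifP => hx; last first.
    rewrite big_seq big1 // => w2 _.
    by case: w1 A1w1 hx (A1n _ A1w1) => //= a u _ ->.
  rewrite [RHS]big_mkcond; apply: eq_big_seq => w2 A2w2.
  have w1n := A1n _ A1w1; have w2n := A2n _ A2w2.
  rewrite seq_descents_cat // !exprD.
  have -> : head 0 (w1 ++ w2) = head 0 w1 by case: (w1) w1n.
  by rewrite hx last_cat; case: (w2) w2n.
apply: eq_bigr => u _; rewrite exchange_big; apply: eq_bigr => v _.
rewrite -!(big_filter_cond (permutations _)) -/A1 -/A2 big_distrlr mulr_suml.
apply: eq_bigr => w1 _; rewrite mulr_suml.
by apply: eq_bigl => w2; rewrite andbC.
Qed.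

(** * Block decks, and positions of cards in subdecks *)

Lemma size_blocks n a b : size (blocks n a b) = \sum_(a <= c < b.+1) n c.
Proof.
rewrite size_flatten sumnE /shape -map_comp big_map.
by apply: eq_bigr => c _ /=; rewrite size_nseq.
Qed.

Lemma mem_blocks n a b c : c \in blocks n a b -> a <= c <= b.
Proof.
by case/flatten_mapP => d; rewrite mem_index_iota mem_nseq => ? /andP[_ /eqP->].
Qed.

Lemma count_blocks n a b c : a <= c <= b -> count_mem c (blocks n a b) = n c.
Proof.
move=> abc; rewrite count_flatten sumnE -map_comp big_map.
rewrite (bigD1_seq c) ?iota_uniq ?mem_index_iota //= count_nseq /= eqxx mul1n.
by rewrite big1 ?addn0 // => d /negPf neq; rewrite count_nseq /= neq.
Qed.

Lemma blocks_cat n a b c : a <= b.+1 -> b <= c ->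
  blocks n a c = blocks n a b ++ blocks n b.+1 c.
Proof.
move=> ab bc; rewrite -flatten_cat -map_cat; congr (flatten (map _ _)).
rewrite /index_iota.
have -> : c.+1 - a = b.+1 - a + (c.+1 - b.+1) by rewrite addnC addnBA // subnK.
by rewrite iotaD subnKC.
Qed.

Lemma head_blocks n a b : a <= b -> 0 < n a -> head 0 (blocks n a b) = a.
Proof.
by rewrite /blocks /index_iota => ab; rewrite subSn //=; case: (n a).
Qed.

Lemma last_blocks n a b : a <= b -> 0 < n b -> last 0 (blocks n a b) = b.
Proof.
move=> ab; rewrite /blocks /index_iota subSn // -[(b - a).+1]addn1 iotaD map_cat.
rewrite flatten_cat subnKC //= cats0 last_cat.
by case: (n b) => //= m _; elim: m.
Qed.

(** Translates a rank in the deck [map lab P] into a letter of [P]. The bound on [i] keeps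
    [card_pos] away from its default value 0. *)
Lemma card_pos_map (P : seq nat) (lab : nat -> nat) i c :
    0 < i <= count_mem c (map lab P) ->
  (0 < card_pos (map lab P) i c <= size P) /\
  nth 0 P (card_pos (map lab P) i c).-1 =
    nth 0 [seq k <- P | lab k == c] i.-1.
Proof.
rewrite /card_pos size_map /index_iota subSS subn0.
set A := filter _ (iota _ _).
have eqA : map (fun k => nth 0 P k.-1) A = [seq k <- P | lab k == c].
  have {2}-> : P = map (fun k => nth 0 P k.-1) (iota 1 (size P)).
    apply: (@eq_from_nth _ 0); rewrite ?size_map ?size_iota // => k ltk.
    by rewrite (nth_map 0) ?size_iota // nth_iota.
  rewrite filter_map; congr map; apply: eq_in_filter => k.
  rewrite mem_iota /= => /andP[k_gt0 lek]; rewrite (nth_map 0) //.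
  by case: k k_gt0 lek.
have szA : size A = count_mem c (map lab P).
  by rewrite -(size_map (fun k => nth 0 P k.-1)) eqA size_filter count_map.
rewrite -szA -eqA; case: i => // i /= lti; rewrite (nth_map 0) //.
split=> //; have := mem_nth 0 lti.
by rewrite mem_filter mem_iota => /and3P[_ ->].
Qed.

Lemma filter_label_subset (P : seq nat) (lab : nat -> nat) (p : pred nat) c :
  p c -> [seq k <- [seq k <- P | p (lab k)] | lab k == c] =
         [seq k <- P | lab k == c].
Proof.
move=> pc; rewrite -filter_predI; apply: eq_filter => k /=.
by case: eqP => //= ->.
Qed.

(** Serves the full deck and both subdecks alike. As [p] holds at [c] and [c'], filtering keeps all
    cards with these labels in order, so the endpoints on the right can be read off in [P]
    itself. *)
Lemma shuffle_poly_filter (P : seq nat) (lab : nat -> nat) (p : pred nat)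
    s c c' i j :
    sorted ltn P -> size s = count p (map lab P) -> p c -> p c' ->
    0 < i <= count_mem c (map lab P) -> 0 < j <= count_mem c' (map lab P) ->
  let E := [seq x <- map lab P | p x] in
  shuffle_poly (size s) s E (card_pos E i c) (card_pos E j c') =
  word_poly [seq k <- P | p (lab k)] lab s
    (nth 0 [seq k <- P | lab k == c] i.-1)
    (nth 0 [seq k <- P | lab k == c'] j.-1).
Proof.
move=> sP szs pc pc' lei lej /=.
rewrite filter_map; set Q := [seq k <- P | _].
have szQ : size s = size Q by rewrite szs count_map size_filter.
have sQ : sorted ltn Q by apply: sorted_filter => //; apply: ltn_trans.
have cQ d : p d -> count_mem d (map lab Q) = count_mem d (map lab P).
  by move=> pd; rewrite !count_map -!size_filter filter_label_subset.
have [posi eqi] := card_pos_map Q lab i c ltac:(by rewrite cQ).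
have [posj eqj] := card_pos_map Q lab j c' ltac:(by rewrite cQ).
rewrite szQ shuffle_polyE // eqi eqj.
by rewrite !(filter_label_subset P lab p).
Qed.

Theorem mainTheorem6 (h : nat) (n : nat -> nat) (D : deck) (e f : nat)
    (hh : 2 <= h)
    (hn : forall c, 1 <= c <= h -> 0 < n c)
    (hD : perm_eq D (blocks n 1 h))
    (he : 1 <= e < h)
    (hf : f = e.+1) :
  let N := \sum_(1 <= c < h.+1) n c in
  let N1 := \sum_(1 <= c < e.+1) n c in
  let N2 := N - N1 in
  let D1e := subdeck D 1 e in
  let Dfh := subdeck D f h in
  let p i j :=
    shuffle_poly N (blocks n 1 h) D (card_pos D i 1) (card_pos D j h) in
  let q i k :=
    shuffle_poly N1 (blocks n 1 e) D1e (card_pos D1e i 1) (card_pos D1e k e) in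
  let r l j :=
    shuffle_poly N2 (blocks n f h) Dfh (card_pos Dfh l f) (card_pos Dfh j h) in
  let eps k l := if card_pos D k e < card_pos D l f then 0 else 1 in
  forall i j : nat, 1 <= i <= n 1 -> 1 <= j <= n h ->
  (p i j = \sum_(1 <= k < (n e).+1) \sum_(1 <= l < (n f).+1)
             q i k * r l j * 'X^(eps k l))%R.
Proof.
move=> N N1 N2 D1e Dfh p q r eps i j lei lej; case/andP: he => e_gt0 lteh.
have f_gt0 : 0 < f by rewrite hf.
have lefh : f <= h by rewrite hf.
have h_gt0 : 0 < h by apply: leq_trans lefh.
have ne_gt0 : 0 < n e by apply: hn; rewrite e_gt0 ltnW.
have nf_gt0 : 0 < n f by apply: hn; rewrite f_gt0.
have blocksE : blocks n 1 h = blocks n 1 e ++ blocks n f h.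
  by rewrite hf -blocks_cat // ltnW.
(* The letters are the positions of [D], numbered from 1. *)
pose lab k := nth 0 D k.-1; pose P := iota 1 (size D).
have mapP : map lab P = D.
  apply: (@eq_from_nth _ 0); rewrite size_map size_iota // => k ltk.
  by rewrite (nth_map 0) ?size_iota // nth_iota.
have sP : sorted ltn P by apply: iota_ltn_sorted.
have uP : uniq P by apply: iota_uniq.
have labD c : c \in D -> 1 <= c <= h by rewrite (perm_mem hD) => /mem_blocks.
have cntD c : 1 <= c <= h -> count_mem c D = n c.
  by move=> hc; rewrite (seq.permP hD) count_blocks.
have NE : N = size (blocks n 1 h) by rewrite size_blocks.
have N1E : N1 = size (blocks n 1 e) by rewrite size_blocks.
have N2E : N2 = size (blocks n f h).
  by rewrite /N2 NE N1E blocksE size_cat addKn.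
have cpD k c : card_pos D k c = nth 0 [seq x <- P | lab x == c] k.-1.
  by rewrite /card_pos /index_iota subn1.
have allL : all (fun c => c <= e) (blocks n 1 e).
  by apply/allP => c /mem_blocks/andP[].
have allR : all (predC (fun c => c <= e)) (blocks n f h).
  by apply/allP => c /mem_blocks/andP[]; rewrite hf /= -ltnNge.
(* All labels of [D] lie between 1 and [h], so the two subdecks are complementary filters. *)
have D1eE : D1e = [seq c <- map lab P | c <= e].
  by rewrite mapP; apply: eq_in_filter => c /labD/andP[->].
have DfhE : Dfh = [seq c <- map lab P | ~~ (c <= e)].
  rewrite mapP; apply: eq_in_filter => c /labD/andP[_ ->].
  by rewrite andbT hf ltnNge.
have szL : size (blocks n 1 e) = count (fun c => c <= e) (map lab P).
  rewrite mapP (seq.permP hD) blocksE count_cat -[LHS]addn0; congr (_ + _).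
    by symmetry; apply/eqP; rewrite -all_count.
  by symmetry; apply/eqP; rewrite -leqn0 leqNgt -has_count -all_predC.
have szR : size (blocks n f h) = count (predC (fun c => c <= e)) (map lab P).
  apply/eqP; rewrite -(eqn_add2l (size (blocks n 1 e))) {2}szL count_predC.
  by rewrite mapP (perm_size hD) blocksE size_cat.
have pE : p i j = word_poly P lab (blocks n 1 e ++ blocks n f h)
                    (card_pos D i 1) (card_pos D j h).
  rewrite /p NE.
  have := shuffle_poly_filter P lab predT (blocks n 1 h) 1 h i j sP.
  rewrite /= filter_predT mapP cntD // cntD ?h_gt0 ?leqnn // -(perm_size hD).
  rewrite count_predT => -> //; rewrite !cpD blocksE.
  by rewrite filter_predT.
have qE k : 1 <= k <= n e -> q i k = word_poly [seq x <- P | lab x <= e] lab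
    (blocks n 1 e) (card_pos D i 1) (card_pos D k e).
  move=> lek; rewrite /q N1E D1eE !cpD.
  apply: (shuffle_poly_filter P lab (fun c => c <= e)) => //;
    by rewrite mapP cntD ?e_gt0 ?h_gt0 ?leqnn // ltnW.
have rE l : 1 <= l <= n f -> r l j = word_poly [seq x <- P | ~~ (lab x <= e)] lab
    (blocks n f h) (card_pos D l f) (card_pos D j h).
  move=> lel; rewrite /r N2E DfhE !cpD.
  apply: (shuffle_poly_filter P lab (predC (fun c => c <= e))) => //=;
    by rewrite -?ltnNge -?hf ?mapP ?cntD ?f_gt0 ?h_gt0 ?leqnn.
rewrite pE (word_poly_cat P lab (fun c => c <= e)) //; first last.
- rewrite -size_eq0 -lt0n; apply: leq_trans nf_gt0 _.
  by rewrite -(count_blocks n f h f) ?count_size // leqnn.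
- rewrite -size_eq0 -lt0n; apply: leq_trans ne_gt0 _.
  by rewrite -(count_blocks n 1 e e) ?count_size // e_gt0 leqnn.
rewrite last_blocks // head_blocks //.
have szC c : 1 <= c <= h -> size [seq k <- P | lab k == c] = n c.
  by move=> hc; rewrite -cntD // -mapP count_map size_filter.
(* Passes from a sum over the positions labeled [e] to one over ranks from 0, matching the sum over
   [k] from 1 after a shift. *)
rewrite (big_nth 0) szC ?e_gt0 ?(ltnW lteh) // [RHS]big_add1 /=.
apply: eq_big_nat => k /andP[_ ltk].
rewrite (big_nth 0) szC ?f_gt0 // [RHS]big_add1 /=.
apply: eq_big_nat => l /andP[_ ltl].
rewrite qE // rE // !cpD /= /eps !cpD /=.
set u := nth 0 _ k; set v := nth 0 _ l.
have labu : lab u = e.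
  have : u \in [seq x <- P | lab x == e] by rewrite mem_nth ?szC ?e_gt0 // ltnW.
  by rewrite mem_filter => /andP[/eqP].
have labv : lab v = f.
  have : v \in [seq x <- P | lab x == f] by rewrite mem_nth ?szC ?f_gt0.
  by rewrite mem_filter => /andP[/eqP].
(* The exponents agree when [u] and [v] differ; equality would force the labels [e] and [e.+1] to
   coincide. *)
case: (ltngtP u v) => // euv.
by move: labv; rewrite -euv labu hf => /n_Sn.
Qed.
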